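(* Let $G$ be a connected graph with $n$ vertices and $m$ edges. Then $$E(G)\leq \sqrt{2mn-IRB(G)}.$$
   Context: All graphs are finite, simple and undirected; $\deg(v)$ denotes the degree of a vertex $v$. The energy $E(G)$ is the sum of the absolute values of the eigenvalues of the adjacency matrix of $G$. The $IRB$-index is $IRB(G)=\sum_{(u,v)\in E(G)}\left(\sqrt{\deg(u)}-\sqrt{\deg(v)}\right)^{2}$, the sum running over edges. *)

(* Defs.v *)
From mathcomp Require Import all_boot all_order all_algebra.

Set Implicit Arguments.
Unset Strict Implicit.
Unset Printing Implicit Defensive.

Import Order.TTheory GRing.Theory Num.Theory.
Local Open Scope ring_scope.

Record sgraph := SGraph {
  vertex :> finType;
  adj : rel vertex;
  adj_sym : symmetric adj;
  adj_irrefl : irreflexive adj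
}.

Section Graph.
Variable G : sgraph.

Definition deg (v : G) : nat := #|[pred w | adj v w]|.

(* Each undirected edge is represented once, by its orientation that is
   increasing for the canonical enumeration of the vertices. *)
Definition edges : {set G * G} :=
  [set p : G * G | adj p.1 p.2 && (enum_rank p.1 < enum_rank p.2)%N].

Definition connected_graph : Prop := forall u v : G, connect (@adj G) u v.

(* C stands for the complex numbers: it can be instantiated with algC, or with
   R[i] for any real closed field R. In C, x <= y means that y - x is real and
   nonnegative. *)
Variable C : numClosedFieldType.

Definition adjmx : 'M[C]_#|G| :=
  \matrix_(i, j) (adj (enum_val i) (enum_val j))%:R.

(* The roots of the characteristic polynomial, with multiplicity. *)
Definition eigenvalues (n : nat) (A : 'M[C]_n) : seq C :=
  sval (closed_field_poly_normal (char_poly A)).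

Definition energy : C := \sum_(z <- eigenvalues adjmx) `|z|.

Definition IRB : C :=
  \sum_(p in edges) (sqrtC (deg p.1)%:R - sqrtC (deg p.2)%:R) ^+ 2.

End Graph.

(* Main.v *)
(** The absolute value |A| of the adjacency matrix A has trace E(G), and by
    Cauchy-Schwarz its diagonal entry at a vertex v is at most
    sqrt((A^2)_vv) = sqrt(deg v); hence E(G) <= \sum_v sqrt(deg v).
    By Lagrange's identity the square of this sum is n \sum_v deg v = 2mn
    minus the sum of (sqrt(deg u) - sqrt(deg v))^2 over all unordered pairs
    {u, v}, and keeping only the adjacent pairs leaves IRB(G). *)

Require Import Defs.
From mathcomp Require Import all_boot all_order all_algebra.
From mathcomp Require Import ring.

Set Implicit Arguments.
Unset Strict Implicit.
Unset Printing Implicit Defensive.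

Import Order.TTheory GRing.Theory Num.Theory.
Local Open Scope ring_scope.

Lemma char_poly_conj (R : comUnitRingType) (n : nat) (P A : 'M[R]_n) :
  P \in unitmx -> char_poly (invmx P *m A *m P) = char_poly A.
Proof.
move=> Punit; rewrite /char_poly /char_poly_mx.
set Q := map_mx polyC P; set Q' := map_mx polyC (invmx P).
have Q'Q : Q' *m Q = 1%:M by rewrite -map_mxM mulVmx // map_mx1.
have -> : 'X%:M - map_mx polyC (invmx P *m A *m P)
          = Q' *m ('X%:M - map_mx polyC A) *m Q.
  rewrite mulmxBr mulmxBl !map_mxM; congr (_ - _).
  by rewrite -mulmxA -scalar_mxC mulmxA Q'Q mul1mx.
by rewrite !det_mulmx mulrAC -det_mulmx Q'Q det1 mul1r.
Qed.

(** Both lists give a factorization of [char_poly A] into monic linear factors, and such a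
    factorization is unique up to order. *)
Lemma perm_eigenvalues_normal (C : numClosedFieldType) (n : nat) (A : 'M[C]_n) :
  A \is normalmx ->
  perm_eq (eigenvalues A) [seq spectral_diag A 0 i | i <- index_enum 'I_n].
Proof.
move=> /orthomx_spectralP A_eq; apply: prod_XsubC_eq.
rewrite /eigenvalues; case: closed_field_poly_normal => s /= s_eq.
have := s_eq; rewrite (monicP (char_poly_monic A)) scale1r => <-.
rewrite big_map {1}A_eq char_poly_conj ?spectral_unit //.
rewrite char_poly_trig ?diag_mx_is_trig //.
by apply: eq_bigr => i _; rewrite mxE eqxx mulr1n.
Qed.

(* The deficit is the variance \sum_i w_i (x_i - mean)^2. *)
Lemma weighted_mean_sqr_le (C : numClosedFieldType) (I : finType)
    (w x : I -> C) :
    (forall i, 0 <= w i) -> (forall i, 0 <= x i) -> \sum_i w i = 1 ->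
  (\sum_i w i * x i) ^+ 2 <= \sum_i w i * x i ^+ 2.
Proof.
move=> w_ge0 x_ge0 w_sum; set e := \sum_i w i * x i.
have e_ge0 : 0 <= e by apply: sumr_ge0 => i _; rewrite mulr_ge0.
rewrite -subr_ge0.
have -> : \sum_i w i * x i ^+ 2 - e ^+ 2 = \sum_i w i * (x i - e) ^+ 2.
  transitivity (\sum_i (w i * x i ^+ 2 - (2 * e) * (w i * x i) + e ^+ 2 * w i)).
    rewrite big_split sumrB -!mulr_sumr w_sum -/e /=; ring.
  by apply: eq_bigr => i _; ring.
apply: sumr_ge0 => i _; rewrite mulr_ge0 //.
by rewrite real_exprn_even_ge0 // realB // ger0_real.
Qed.

(** Diagonalize [A] by a unitary [P]. For fixed [i] the weights [|P k i|^2] sum to 1 over [k]; under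
    them the mean of [|d_k|] is the [i]-th diagonal entry of the absolute value of [A], and the mean
    of [|d_k|^2] is that of [A A^*]. *)
Lemma sum_norm_eigenvalues_le (C : numClosedFieldType) (n : nat) (A : 'M[C]_n) :
  A \is normalmx ->
  \sum_(z <- eigenvalues A) `|z| <= \sum_i sqrtC (\sum_j `|A i j| ^+ 2).
Proof.
move=> Anormal; rewrite (perm_big _ (perm_eigenvalues_normal Anormal)) big_map.
have /orthomx_spectralP := Anormal.
set P := spectralmx A; set d := spectral_diag A => A_eq.
have Punitary : P \is unitarymx := spectral_unitarymx A.
have PPt := unitarymxP Punitary.
have PtP : P ^t*%sesqui *m P = 1%:M.
  by rewrite -invmx_unitary // mulVmx // unitarymx_unit.
have row1 k : \sum_i `|P k i| ^+ 2 = 1.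
  have /matrixP/(_ k k) := PPt; rewrite !mxE eqxx mulr1n => <-.
  by apply: eq_bigr => i _; rewrite !mxE normCK.
have col1 i : \sum_k `|P k i| ^+ 2 = 1.
  have /matrixP/(_ i i) := PtP; rewrite !mxE eqxx mulr1n => <-.
  by apply: eq_bigr => k _; rewrite !mxE normCK mulrC.
have AAt : A *m A ^t*%sesqui
    = P ^t*%sesqui *m diag_mx (\row_k (`|d 0 k| ^+ 2)) *m P.
  rewrite {1 2}A_eq invmx_unitary // !trmx_mul !map_mxM trmxCK !mulmxA.
  rewrite mulmxtVK // -[X in X *m P = _]mulmxA tr_diag_mx map_diag_mx mulmx_diag.
  congr (_ *m diag_mx _ *m _); apply/rowP => k.
  by rewrite !mxE normCK.
have rowA i : \sum_j `|A i j| ^+ 2 = \sum_k `|P k i| ^+ 2 * `|d 0 k| ^+ 2.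
  have /matrixP/(_ i i) := AAt; rewrite !mxE => AAt_ii.
  transitivity (\sum_j A i j * A ^t*%sesqui j i).
    by apply: eq_bigr => j _; rewrite !mxE normCK.
  rewrite AAt_ii; apply: eq_bigr => k _.
  by rewrite mul_mx_diag !mxE [in RHS]normCK; ring.
(* The trace of the absolute value of [A]: each [|d_k|] is spread over the indices [i], since the
   rows of [P] are unit vectors. *)
have -> : \sum_k `|d 0 k| = \sum_i \sum_k `|P k i| ^+ 2 * `|d 0 k|.
  rewrite exchange_big; apply: eq_bigr => k _.
  by rewrite -mulr_suml row1 mul1r.
apply: ler_sum => i _; rewrite rowA.
have mean_ge0 : 0 <= \sum_k `|P k i| ^+ 2 * `|d 0 k|.
  by apply: sumr_ge0 => k _; rewrite mulr_ge0 ?exprn_ge0.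
rewrite -[leLHS]sqrCK // ler_sqrtC ?nnegrE ?exprn_ge0 //.
  by apply: weighted_mean_sqr_le => // k; rewrite exprn_ge0.
by apply: sumr_ge0 => k _; rewrite mulr_ge0 ?exprn_ge0.
Qed.

(** Expand the square. The factor 2 arises because ordered pairs are summed. *)
Lemma lagrange_identity (R : comNzRingType) (I : finType) (x : I -> R) :
  \sum_i \sum_j (x i - x j) ^+ 2
  = 2 * (#|I|%:R * (\sum_i x i ^+ 2) - (\sum_i x i) ^+ 2).
Proof.
have sum_const (a : R) : \sum_(i : I) a = #|I|%:R * a.
  by rewrite sumr_const mulr_natl.
have inner i : \sum_j (x i - x j) ^+ 2
    = #|I|%:R * x i ^+ 2 + (-2 * \sum_j x j) * x i + \sum_j x j ^+ 2.
  transitivity (\sum_j (x i ^+ 2 + (-2 * x i) * x j + x j ^+ 2)).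
    by apply: eq_bigr => j _; ring.
  rewrite !big_split /= sum_const -mulr_sumr; ring.
under eq_bigr do rewrite inner.
rewrite !big_split /= sum_const -!mulr_sumr; ring.
Qed.

(** Swapping the endpoints exchanges the increasing and decreasing orientations of edges. *)
Lemma sum_adj (G : sgraph) (V : zmodType) (F : G -> G -> V) :
    (forall u v, F u v = F v u) ->
  \sum_u \sum_(v | adj u v) F u v = (\sum_(p in edges G) F p.1 p.2) *+ 2.
Proof.
move=> Fsym; rewrite pair_big_dep /=.
rewrite (bigID (fun p : G * G => (enum_rank p.1 < enum_rank p.2)%N)) /= mulr2n.
congr (_ + _); first by apply: eq_bigl => p; rewrite inE.
rewrite (reindex_inj (h := fun p : G * G => (p.2, p.1))) /=; last first.
  by move=> [a b] [c e] /= [-> ->].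
apply: eq_big => [[u v]|[u v] _] /=; last exact: Fsym.
(* Equal ranks would make the edge a loop. *)
rewrite inE /= adj_sym -leqNgt leq_eqVlt andb_orr; apply: orb_idl.
by move=> /andP[uv /eqP/val_inj/enum_rank_inj uv_eq]; rewrite uv_eq adj_irrefl in uv.
Qed.

Lemma natr_deg (R : pzSemiRingType) (G : sgraph) (v : G) :
  (deg v)%:R = \sum_(w | adj v w) 1 :> R.
Proof. by rewrite /deg -sum1_card natr_sum. Qed.

Lemma sum_deg (G : sgraph) : (\sum_(v : G) deg v = 2 * #|edges G|)%N.
Proof.
(* The count moves to the integers because [sum_adj] takes values in a [zmodType]. *)
apply/eqP; rewrite -eqz_nat; apply/eqP; rewrite -!natz natr_sum.
under eq_bigr do rewrite natr_deg.
by rewrite (sum_adj (F := fun _ _ => 1)) // sumr_const natrM mulr_natl.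
Qed.

Lemma adjmx_normal (C : numClosedFieldType) (G : sgraph) :
  adjmx G C \is normalmx.
Proof.
have At : (adjmx G C ^t*)%sesqui = adjmx G C.
  by apply/matrixP => i j; rewrite !mxE conjC_nat adj_sym.
by apply/normalmxP; rewrite At.
Qed.

Lemma energy_le_sum_sqrt_deg (C : numClosedFieldType) (G : sgraph) :
  energy G C <= \sum_(v : G) sqrtC (deg v)%:R.
Proof.
apply: le_trans (sum_norm_eigenvalues_le (adjmx_normal C G)) _.
rewrite [leRHS](reindex _ (onW_bij _ (enum_val_bij G))) /=.
(* The terms are in fact equal: entries 0 and 1 are their own squared moduli, so a row sums to the
   degree. *)
apply: ler_sum => i _; rewrite le_eqVlt; apply/orP; left; apply/eqP; congr sqrtC.
rewrite natr_deg [RHS]big_mkcond /=.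
rewrite [RHS](reindex _ (onW_bij _ (enum_val_bij G))) /=.
apply: eq_bigr => j _; rewrite mxE normr_nat.
by case: adj; rewrite ?expr1n ?expr0n.
Qed.

Theorem theorem2p5 (C : numClosedFieldType) (G : sgraph) (n m : nat)
    (Gn : #|G| = n) (Gm : #|edges G| = m) (Gconn : connected_graph G) :
  energy G C <= sqrtC ((2 * m * n)%:R - IRB G C).
Proof.
have energy_ge0 : 0 <= energy G C by apply: sumr_ge0.
pose x v : C := sqrtC (deg (v : G))%:R.
have x_ge0 v : 0 <= x v by rewrite sqrtC_ge0 ler0n.
have sqrB_ge0 u v : 0 <= (x u - x v) ^+ 2.
  by rewrite real_exprn_even_ge0 // realB // ger0_real.
have IRB_le : IRB G C *+ 2 <= \sum_u \sum_v (x u - x v) ^+ 2.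
  rewrite -(sum_adj (F := fun u v => (x u - x v) ^+ 2)); last by move=> u v; ring.
  apply: ler_sum => u _; rewrite [leRHS](bigID (adj u)) /= lerDl.
  exact: sumr_ge0.
have sum_sqr : \sum_v x v ^+ 2 = (2 * m)%:R.
  rewrite -Gm -sum_deg natr_sum; apply: eq_bigr => v _; exact: sqrtCK.
have energy_sqr : energy G C ^+ 2 <= (2 * m * n)%:R - IRB G C.
  apply: (@le_trans _ _ ((\sum_v x v) ^+ 2)).
    by rewrite ler_pXn2r ?nnegrE ?sumr_ge0 ?energy_le_sum_sqrt_deg.
  (* Doubling the difference matches it with [IRB_le], whose right side runs over ordered pairs. *)
  rewrite -subr_ge0 -(pmulr_rge0 _ (ltr0Sn C 1)).
  move: IRB_le; rewrite lagrange_identity sum_sqr Gn -subr_ge0.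
  by congr (0 <= _); rewrite !natrM; ring.
rewrite -[leLHS]sqrCK // ler_sqrtC ?nnegrE ?exprn_ge0 //.
by apply: le_trans energy_sqr; rewrite exprn_ge0.
Qed.
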